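(* Let $X$ be a finite-dimensional Banach space and let $(A_m)_{m\ge 0}$ be a sequence of (bounded) linear operators on $X$ such that the system $x_{n+1}=A_nx_n$, $n\ge 0$, has the $l^\infty$-Lipschitz shadowing property. Then $(A_m)_{m\ge 0}$ admits an exponential dichotomy on $\mathbb Z_0^+=\{0,1,2,\dots\}$.
   Context: **$l^\infty$-Lipschitz shadowing (one-sided).** For $\delta>0$, a sequence $(y_n)_{n\ge 0}\subset X$ is a $(\delta,l^\infty)$-pseudotrajectory for $x_{n+1}=A_nx_n$, $n\ge 0$, if $\sup_{n\ge 0}\|y_{n+1}-A_ny_n\|\le\delta$. The system has the $l^\infty$-Lipschitz shadowing property if there is $L>0$ such that for every $\varepsilon>0$, with $\delta=L\varepsilon$, for every $(\delta,l^\infty)$-pseudotrajectory $(y_n)_{n\ge 0}$ there is a sequence $(x_n)_{n\ge 0}\subset X$ with $x_{n+1}=A_nx_n$ for all $n\ge 0$ and $\sup_{n\ge 0}\|x_n-y_n\|\le\varepsilon$. **Exponential dichotomy on $\mathbb Z_0^+$.** For $m\ge n\ge 0$ set $\mathcal A(m,n)=A_{m-1}\cdots A_n$ if $m>n$ and $\mathcal A(m,m)=\mathrm{Id}$. The sequence $(A_m)_{m\ge 0}$ admits an exponential dichotomy if: (1) there are projections $P_m$, $m\ge 0$, on $X$ with $P_{m+1}A_m=A_mP_m$ for all $m\ge 0$; (2) $A_m|_{\ker P_m}\colon\ker P_m\to\ker P_{m+1}$ is invertible for all $m\ge 0$; (3) there exist $C,\lambda>0$ such that for $m,n\ge 0$,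 $\|\mathcal A(m,n)P_n\|\le Ce^{-\lambda(m-n)}$ if $m\ge n$ and $\|\mathcal A(m,n)(\mathrm{Id}-P_n)\|\le Ce^{-\lambda(n-m)}$ if $m\le n$, where for $m\le n$, $\mathcal A(m,n):=(\mathcal A(n,m)|_{\ker P_m})^{-1}\colon\ker P_n\to\ker P_m$. *)

(* Defs.v *)
From HB Require Import structures.
From mathcomp Require Import all_boot all_order all_algebra.
From mathcomp Require Export complex.
From mathcomp Require Import all_classical all_reals all_analysis.

Set Implicit Arguments.
Unset Strict Implicit.
Unset Printing Implicit Defensive.

Import Order.TTheory GRing.Theory Num.Theory.
Import numFieldNormedType.Exports.

Local Open Scope classical_set_scope.
Local Open Scope ring_scope.

(* Norms on a [normedModType K] take their values in [K].  The definitions are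
   generic in [K] so that they cover both real spaces ([K = R]) and complex ones
   ([K = R[i]]); in the order of [R[i]], [0 < c] says that [c] is a positive
   real, so the constants below range over the positive reals in both cases. *)

Definition finite_dimensional (K : fieldType) (X : lmodType K) : Prop :=
  exists (d : nat) (e : 'I_d -> X),
    forall x : X, exists c : 'I_d -> K, x = \sum_(i < d) c i *: e i.

Section System.
Variables (K : numFieldType) (X : normedModType K).
Implicit Types A P : nat -> {linear X -> X}.

Definition trajectory A (x : nat -> X) : Prop :=
  forall n, x n.+1 = A n (x n).

(* [sup_n `|u n| <= c], without forming the supremum. *)
Definition sup_norm_le (u : nat -> X) (c : K) : Prop :=
  forall n, `|u n| <= c.

Definition pseudotrajectory A (delta : K) (y : nat -> X) : Prop :=
  sup_norm_le (fun n => y n.+1 - A n (y n)) delta.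

Definition lipschitz_shadowing A : Prop :=
  exists2 L : K, 0 < L &
    forall eps : K, 0 < eps ->
    forall y : nat -> X, pseudotrajectory A (L * eps) y ->
    exists2 x : nat -> X, trajectory A x & sup_norm_le (fun n => x n - y n) eps.

Definition ker (f : X -> X) : set X := [set x | f x = 0].

(* [A_{m-1} \o ... \o A_n] if [n < m], and the identity if [m = n]. *)
Definition forward_evolution A (m n : nat) : X -> X :=
  fun x => foldl (fun z k => A k z) x (index_iota n m).

(* For [m < n] the library's [pinv_] is the inverse of the restriction of
   [forward_evolution A n m] to [ker (P m)]; outside the image [ker (P n)] of
   this restriction it takes the irrelevant default value [0]. *)
Definition evolution A P (m n : nat) : X -> X :=
  if (n <= m)%N then forward_evolution A m n
  else 'pinv_(fun=> 0) (ker (P m)) (forward_evolution A n m).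

(* Operator norm bound [||f|| <= c], for [c >= 0]. *)
Definition opnorm_le (f : X -> X) (c : K) : Prop :=
  forall x, `|f x| <= c * `|x|.

(* [iota] embeds the reals in the scalar field. *)
Definition exponential_dichotomy (R : realType) (iota : R -> K) A : Prop :=
  exists P : nat -> {linear X -> X},
  [/\ forall m x, P m (P m x) = P m x,
      forall m x, P m.+1 (A m x) = A m (P m x),
      forall m, set_bij (ker (P m)) (ker (P m.+1)) (A m) &
      exists C lambda : R, [/\ 0 < C, 0 < lambda,
        forall m n, (n <= m)%N ->
          opnorm_le (fun x => evolution A P m n (P n x))
                    (iota (C * expR (- lambda * (m%:R - n%:R)))) &
        forall m n, (m <= n)%N ->
          opnorm_le (fun x => evolution A P m n (x - P n x))
                    (iota (C * expR (- lambda * (n%:R - m%:R))))]].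

End System.

(* Main.v *)
Require Import Defs.
From HB Require Import structures.
From mathcomp Require Import all_boot all_order all_algebra.
From mathcomp Require Import all_classical all_reals all_analysis.
From mathcomp Require Import zify lra.

(** Let [F m n] denote the product of the operators from time [n] to time [m].
    Shadowing says that an inhomogeneous equation z(k+1) = A_k z(k) + w(k) with
    bounded forcing has a bounded solution controlled by the forcing: if [y]
    is any solution of it and [x] shadows [y], then [y - x] is one.  This is the
    admissibility condition of Perron, and the proof turns it into a dichotomy.

    Let S(n) be the space of the vectors whose forward orbit from time [n] is
    bounded ([stable]).  As the space is finite dimensional, S(0) is the range
    of a bounded linear projection [Q]; let U(n) be the image of the kernel of
    [Q] under [F n 0] ([unstable]).  A solution that is bounded and
    starts in the kernel of [Q] is unique, and [perron_estimate] bounds it by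
    a constant times the forcing.  The whole theorem follows by feeding suitable
    sequences to this one inequality.

    - A forcing concentrated at the single time [n - 1] gives the splitting of
      the space into S(n) and U(n), a uniform bound for the projections onto
      S(n) along U(n), and uniform bounds for the growth of orbits, forward in
      S(n) and backward in U(n) ([stable_unstable_split], [green_estimate]).  Time [0],
      which no forcing reaches, is covered by the bound for [Q] and for the orbits
      in S(0).
    - For an orbit [x] in the stable spaces, the sequence that equals
      (k - n) x(k) up to time [m] and (m - n) x(k) afterwards solves the equation
      with forcing x(k+1), which is bounded by a multiple of |x(n)|.  Hence
      (m - n) |x(m)| is at most a constant times |x(n)|, and the same works
      backward in the unstable spaces ([stable_linear_decay],
      [unstable_linear_decay]).
    - Such a decay, uniform in the starting time, forces the norm to be halved
      over every window of some fixed length, hence to decay exponentially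
      ([exp_decay]).

    Finite dimension is used twice: to have a complement of S(0), and to bound
    [Q] together with the orbits in S(0), which needs bounded coordinates and thus
    the compactness of the unit sphere ([rV_norm_dominates]).

    The argument is carried out once for a scalar field [K] that receives the
    reals by an order embedding [iota] through which every nonnegative scalar is
    real; both the real and the complex scalars are of this kind. *)

Set Implicit Arguments.
Unset Strict Implicit.
Unset Printing Implicit Defensive.

Import Order.TTheory GRing.Theory Num.Theory.
Import numFieldNormedType.Exports.

Local Open Scope ring_scope.
Local Open Scope complex_scope.

(** * Complements of subspaces *)

Section LinearAlgebra.
Variables (K : fieldType) (X : lmodType K).

Definition linear_subspace (S : X -> Prop) : Prop :=
  S 0 /\ forall a u v, S u -> S v -> S (a *: u + v).

Lemma linear_subspaceB S u v : linear_subspace S -> S u -> S v -> S (u - v).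
Proof. by move=> [_ h] Su Sv; rewrite addrC -scaleN1r; exact: h. Qed.

Lemma linear_subspaceD S u v : linear_subspace S -> S u -> S v -> S (u + v).
Proof. by move=> [_ h] Su Sv; rewrite -[u]scale1r; exact: h. Qed.

Lemma linear_subspaceZ S a u : linear_subspace S -> S u -> S (a *: u).
Proof. by move=> [h0 h] Su; rewrite -[_ *: _]addr0; exact: h. Qed.

Lemma linear_subspace_sum S (I : finType) (P : pred I) (F : I -> X) :
  linear_subspace S -> (forall i, P i -> S (F i)) -> S (\sum_(i | P i) F i).
Proof.
move=> hS hF; elim/big_ind: _ => //; first by case: hS.
by move=> x y; exact: linear_subspaceD.
Qed.

(** The component along [S] is picked by choice; being unique, it depends
    linearly on the vector. *)
Lemma direct_sum_projection (S U : X -> Prop) :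
  linear_subspace S -> linear_subspace U ->
  (forall x, S x -> U x -> x = 0) ->
  (forall x, exists s, S s /\ U (x - s)) ->
  exists P : {linear X -> X}, forall x, S (P x) /\ U (x - P x).
Proof.
move=> hS hU SU0 /boolp.choice[f fP].
have f_linear : linear f.
  move=> a u v; apply/eqP; rewrite -subr_eq0; apply/eqP; apply: SU0.
    apply: linear_subspaceB => //; first by case: (fP (a *: u + v)).
    by case: hS => _; apply; [case: (fP u)|case: (fP v)].
  have -> : f (a *: u + v) - (a *: f u + f v) =
    a *: (u - f u) + (v - f v) - (a *: u + v - f (a *: u + v)).
    by rewrite scalerBr addrACA -opprD opprB [RHS]addrC addrA subrK.
  apply: linear_subspaceB => //; last by case: (fP (a *: u + v)).
  by case: hU => _; apply; [case: (fP u)|case: (fP v)].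
pose P : {linear X -> X} := HB.pack f (GRing.isLinear.Build K X X _ f f_linear).
by exists P.
Qed.

(** A complement can be spanned by part of any finite spanning family: take a
    subfamily that is maximal among those whose span meets [S] only in [0].
    If a further generator were outside of [S + U], it could be added. *)
Lemma subspace_complement (S : X -> Prop) :
  finite_dimensional X -> linear_subspace S ->
  exists U : X -> Prop, [/\ linear_subspace U,
    forall x, S x -> U x -> x = 0 & forall x, exists s, S s /\ U (x - s)].
Proof.
move=> [d [e e_span]] hS.
(* [U I] is the span of the generators indexed by [I]. *)
pose U (I : {set 'I_d}) x := exists2 c : 'I_d -> K,
  (forall i, i \notin I -> c i = 0) & x = \sum_i c i *: e i.
have hU I : linear_subspace (U I).
  split; first by exists (fun=> 0) => //; rewrite big1 // => i _; rewrite scale0r.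
  move=> a _ _ [c c0 ->] [c' c'0 ->]; exists (fun i => a * c i + c' i).
    by move=> i iI; rewrite c0 // c'0 // mulr0 addr0.
  rewrite scaler_sumr -big_split /=; apply: eq_bigr => i _.
  by rewrite scalerDl scalerA.
pose indep (I : {set 'I_d}) := `[< forall x, S x -> U I x -> x = 0 >].
have indep0 : indep finset.set0.
  apply/asboolP => x _ [c c0 ->]; rewrite big1 // => i _.
  by rewrite c0 ?scale0r // inE.
case: (@arg_maxnP _ finset.set0 indep (fun I : {set 'I_d} => #|I|) indep0) => I /asboolP I_indep I_max.
exists (U I); split => //.
have SU_e j : exists s, S s /\ U I (e j - s).
  have [jI|jI] := boolP (j \in I).
    exists 0; split; first by case: hS.
    rewrite subr0; exists (fun i => (i == j)%:R).
      by move=> i iI; case: eqP => // ij; rewrite -ij (negbTE iI) in jI.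
    rewrite (bigD1 j) //= eqxx scale1r big1 ?addr0 // => i /negbTE ->.
    by rewrite scale0r.
  have : ~~ indep (j |: I)%SET.
    by apply/negP => /I_max; rewrite /= cardsU1 jI add1n ltnn.
  move=> /asboolPn/existsNP[v] /not_implyP[Sv] /not_implyP[[c c0 vE] v0].
  have cj0 : c j != 0.
    apply/eqP => cj; apply: v0; apply: I_indep => //; exists c => // i iI.
    have [->//|ij] := eqVneq i j.
    by apply: c0; rewrite !inE negb_or ij.
  exists ((c j)^-1 *: v); split; first exact: linear_subspaceZ.
  have -> : e j - (c j)^-1 *: v =
      \sum_i (if i == j then 0 else - (c j)^-1 * c i) *: e i.
    rewrite vE (bigD1 j) //= scalerDr scalerA mulVf // scale1r opprD addrA subrr.
    rewrite add0r [RHS](bigD1 j) //= eqxx scale0r add0r scaler_sumr -sumrN.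
    by apply: eq_bigr => i /negbTE ->; rewrite scalerA mulNr scaleNr.
  eexists; last by [].
  move=> i iI /=; case: eqP => // /eqP ij; rewrite (c0 i) ?mulr0 //.
  by rewrite !inE negb_or ij.
have [s sP] := boolp.choice SU_e.
move=> x; have [c ->] := e_span x.
exists (\sum_i c i *: s i); split.
  by apply: linear_subspace_sum => // i _; apply: linear_subspaceZ => //; case: (sP i).
rewrite -sumrB; apply: linear_subspace_sum => // i _; rewrite -scalerBr.
by apply: linear_subspaceZ => //; case: (sP i).
Qed.

Lemma projection_onto (S : X -> Prop) :
  finite_dimensional X -> linear_subspace S ->
  exists Q : {linear X -> X}, forall x, S (Q x) /\ (S x -> Q x = x).
Proof.
move=> fdX hS; have [U [hU SU0 SU]] := subspace_complement fdX hS.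
have [Q QP] := direct_sum_projection hS hU SU0 SU.
exists Q => x; split; first by case: (QP x).
move=> Sx; apply/esym/eqP; rewrite -subr_eq0; apply/eqP/SU0; last by case: (QP x).
by apply: linear_subspaceB => //; case: (QP x).
Qed.

End LinearAlgebra.

(** * Bounded coordinates in finite dimension *)

Section FiniteDimension.
Variables (R : realType).

(** A norm on a finite-dimensional real space is continuous for the sup norm,
    so it attains a minimum on the compact unit sphere, and this minimum is
    positive. *)
Lemma rV_norm_dominates n (N : 'rV[R]_n -> R) :
  (forall u v, N (u + v) <= N u + N v) ->
  (forall a v, N (a *: v) = `|a| * N v) ->
  (forall v, N v = 0 -> v = 0) ->
  exists M : R, forall v, `|v| <= M * N v.
Proof.
move=> ND NZ N0.
have N00 : N 0 = 0 by have := NZ 0 0; rewrite scale0r normr0 mul0r.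
have NN v : N (- v) = N v by rewrite -scaleN1r NZ normrN1 mul1r.
have N_ge0 v : 0 <= N v.
  by have := ND v (- v); rewrite subrr NN N00; lra.
have [u0|/existsNP[u /eqP u0]] := pselect (forall u : 'rV[R]_n, u = 0).
  by exists 0 => v; rewrite (u0 v) normr0 mul0r.
pose B := \sum_i N (delta_mx ord0 i).
have B_ge0 : 0 <= B by apply: sumr_ge0.
have coord_le (v : 'rV[R]_n) i : `|v ord0 i| <= `|v|.
  rewrite [leRHS]/Num.Def.normr /= mx_normrE.
  by apply/bigmax_geP; right => /=; exists (ord0, i).
have NB v : N v <= B * `|v|.
  rewrite {1}[v]row_sum_delta mulr_suml.
  apply: (@le_trans _ _ (\sum_j N (v ord0 j *: delta_mx ord0 j))).
    elim/big_ind2: _ => //; first by rewrite N00.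
    by move=> x1 x2 y1 y2 h1 h2; apply: (le_trans (ND _ _)); exact: lerD.
  by apply: ler_sum => j _; rewrite NZ mulrC ler_wpM2l.
have N_dist u1 v1 : `|N u1 - N v1| <= B * `|u1 - v1|.
  have h w z : N w - N z <= B * `|w - z|.
    by rewrite lerBlDr -{1}[w](subrK z); apply: (le_trans (ND _ _)); rewrite lerD2r.
  by rewrite ler_norml h andbT lerNl opprB distrC h.
have N_cont : continuous N.
  move=> x; apply/(@cvgrPdist_le R R 'rV[R]_n (nbhs x) _ N (N x)) => e e0.
  have Bp : 0 < B + 1 by rewrite ltr_wpDl.
  have eB : 0 < e / (B + 1) by rewrite divr_gt0.
  have nbhs_x : Filter (nbhs x) := @nbhs_filter 'rV[R]_n x.
  have near_x := @cvgr_dist_le _ 'rV[R]_n _ (nbhs x) _ id x cvg_id _ eB.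
  have sub (y : 'rV[R]_n) : `|x - y| <= e / (B + 1) -> `|N x - N y| <= e.
    rewrite ler_pdivlMr // mulrC => xy.
    apply: (le_trans (N_dist _ _)); apply: le_trans xy.
    by rewrite ler_wpM2r // lerDl.
  exact: (@filterS _ (nbhs x) nbhs_x _ _ sub (near_x nbhs_x)).
pose S : set ('rV[R]_n) := [set v : 'rV[R]_n | `|v| = 1]%classic.
have S0 : S !=set0%classic.
  exists (`|u|^-1 *: u); rewrite /S /= normrZ normrV ?unitfE ?normr_eq0 //.
  by rewrite normr_id mulVf // normr_eq0.
have S_compact : compact S.
  apply: bounded_closed_compact.
    by exists 1; split; [exact: num_real|move=> x x1 v /= ->; exact: ltW].
  have := @preimage_closed 'rV[R]_n R (fun v : 'rV[R]_n => `|v|) [set x | x = 1]%classic.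
  apply; last exact: closed_eq.
  by move=> v _; exact: norm_continuous.
have [c cS c_min] := EVT_min_rV S0 S_compact (continuous_subspaceT N_cont).
have Nc0 : 0 < N c.
  rewrite lt_neqAle N_ge0 andbT eq_sym; apply/eqP => /N0 c0.
  by move: cS; rewrite inE /S /= c0 normr0 => /eqP; rewrite eq_sym oner_eq0.
exists (N c)^-1 => v; rewrite mulrC ler_pdivlMr //.
have [->|v0] := eqVneq v 0; first by rewrite normr0 mul0r.
have nv0 : 0 < `|v| by rewrite normr_gt0.
have : N c <= N (`|v|^-1 *: v).
  apply: c_min; rewrite inE /S /= normrZ normrV ?unitfE ?normr_eq0 //.
  by rewrite normr_id mulVf // normr_eq0.
by rewrite NZ normrV ?unitfE ?gt_eqF // normr_id mulrC ler_pdivlMr // mulrC.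
Qed.

Section RealCoordinates.
Variables (K : numFieldType) (X : normedModType K) (iota : {rmorphism R -> K}).
Hypothesis iota_mono : {mono iota : r s / r <= s}.
Hypothesis iota_onto : forall k : K, 0 <= k -> exists r, k = iota r.

(** Scalars are restricted to the reals: a complex space has a real spanning
    family too, and the compactness argument takes place over the reals. *)
Definition real_spanning n (f : 'I_n -> X) : Prop :=
  forall x, exists a : 'I_n -> R, x = \sum_i iota (a i) *: f i.

Lemma iota_ge0 r : (0 <= iota r) = (0 <= r).
Proof. by rewrite -(rmorph0 iota) iota_mono. Qed.

Lemma iota_norm r : `|iota r| = iota `|r|.
Proof.
have [r0|r0] := leP 0 r; first by rewrite !ger0_norm ?iota_ge0.
rewrite !ler0_norm ?(ltW r0) ?rmorphN //.
by rewrite -(rmorph0 iota) iota_mono ltW.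
Qed.

(** As long as there is a relation in which [a k] is not zero, the generator of
    index [k] can be dropped. *)
Lemma real_basis n (f : 'I_n -> X) : real_spanning f ->
  exists d (g : 'I_d -> X), real_spanning g /\
    forall a : 'I_d -> R, \sum_i iota (a i) *: g i = 0 -> forall i, a i = 0.
Proof.
elim: n f => [|n IHn] f f_span; first by exists 0, f; split => // a _ [].
have [f_free|/existsNP[a /not_implyP[a_rel /existsNP[k /eqP ak]]]] :=
  pselect (forall a : 'I_n.+1 -> R, \sum_i iota (a i) *: f i = 0 -> forall i, a i = 0).
  by exists n.+1, f.
apply: (IHn (fun j => f (lift k j))) => x; have [b ->] := f_span x.
exists (fun j => b (lift k j) - b k / a k * a (lift k j)).
have -> : \sum_i iota (b i) *: f i =
    \sum_i iota (b i) *: f i - iota (b k / a k) *: (\sum_i iota (a i) *: f i).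
  by rewrite a_rel scaler0 subr0.
rewrite scaler_sumr -sumrB (bigD1_ord k) //= scalerA -rmorphM divfK // subrr add0r.
by apply: eq_bigr => i _; rewrite scalerA -scalerBl -rmorphM -rmorphB.
Qed.

(** On a real basis the norm of [X] induces a norm on the coordinate vectors. *)
Lemma bounded_real_coordinates n (f : 'I_n -> X) : real_spanning f ->
  exists d (g : 'I_d -> X) (M : K), 0 <= M /\ forall x, exists2 a : 'I_d -> K,
    x = \sum_i a i *: g i & forall i, `|a i| <= M * `|x|.
Proof.
move=> /real_basis[d [g [g_span g_free]]].
have [rho rhoE] : exists rho : X -> R, forall x, `|x| = iota (rho x).
  have [x|rho rhoP] := @boolp.choice X R (fun x r => `|x| = iota r); last by exists rho.
  exact: iota_onto.
pose h (v : 'rV[R]_d) := \sum_i iota (v ord0 i) *: g i.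
have [u v|a v|v|M hM] := @rV_norm_dominates d (fun v => rho (h v)).
- rewrite -iota_mono rmorphD -!rhoE.
  have -> : h (u + v) = h u + h v.
    by rewrite -big_split; apply: eq_bigr => i _; rewrite mxE rmorphD scalerDl.
  exact: ler_normD.
- apply: (fmorph_inj iota); rewrite rmorphM -iota_norm -!rhoE -normrZ; congr (`|_|).
  by rewrite scaler_sumr; apply: eq_bigr => i _; rewrite mxE rmorphM scalerA.
- move=> rho0; apply/rowP => i; rewrite mxE.
  apply: (g_free (fun i => v ord0 i)); apply/eqP.
  by rewrite -normr_eq0 rhoE rho0 rmorph0.
exists d, g, (iota `|M|); split=> [|x]; first by rewrite iota_ge0.
have [a xE] := g_span x.
exists (iota \o a) => // i; rewrite iota_norm rhoE -rmorphM iota_mono.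
have -> : x = h (\row_i a i).
  by rewrite xE; apply: eq_bigr => j _; rewrite mxE.
apply: (@le_trans _ _ (M * rho (h (\row_i a i)))); last first.
  rewrite ler_wpM2r ?ler_norm // -iota_ge0 -rhoE; exact: normr_ge0.
apply: le_trans (hM _); rewrite [leRHS]/Num.Def.normr /= mx_normrE.
by apply/bigmax_geP; right; exists (ord0, i) => //=; rewrite mxE.
Qed.

End RealCoordinates.
End FiniteDimension.

(** * From linear to exponential decay *)

Section ExponentialDecay.
Variables (R : realType) (K : numFieldType) (iota : {rmorphism R -> K}).
Hypothesis iota_mono : {mono iota : r s / r <= s}.
Hypothesis iota_onto : forall k : K, 0 <= k -> exists r, k = iota r.

(** The factor [2] pays for rounding [j / N] down. *)
Lemma halving_le_expR N j : (0 < N)%N ->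
  (2^-1 : R) ^+ (j %/ N) <= 2 * expR (- (ln 2 / N%:R) * j%:R).
Proof.
move=> N0; set q := (j %/ N)%N.
have -> : (2^-1 : R) ^+ q = 2 * expR (- ln 2 * q.+1%:R).
  rewrite mulNr expRN [ln 2 * _]mulrC expRM_natl lnK ?posrE //.
  by rewrite exprS invfM mulVKf // exprVn.
rewrite ler_pM2l // ler_expR !mulNr lerN2 mulrAC -mulrA ler_pM2l ?ln_gt0 ?ltr1n //.
rewrite ler_pdivrMr ?ltr0n // -natrM ler_nat mulnC.
by rewrite [j in (j <= _)%N](divn_eq j N) mulnS addnC mulnC leq_add2r ltnW ?ltn_mod.
Qed.

(** When [N >= 2 D], the bound [(j - i) g(j) <= D g(i)] gives
    [g (i + N) <= g i / 2].  Iterating this along the multiples of [N], and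
    covering the remaining steps with the factor [C], gives the rate [ln 2 / N].
    The horizon [T] is there because the backward orbits in the unstable spaces
    are finite; the rate must not depend on it. *)
Lemma exp_decay (C D : K) : 0 <= C -> 0 <= D ->
  exists C' lambda : R, [/\ 0 < C', 0 < lambda &
    forall (T : nat) (g : nat -> K), (forall j, 0 <= g j) ->
    (forall i j, (i <= j <= T)%N -> g j <= C * g i) ->
    (forall i j, (i <= j <= T)%N -> (j - i)%:R * g j <= D * g i) ->
    forall j, (j <= T)%N -> g j <= iota (C' * expR (- lambda * j%:R)) * g 0%N].
Proof.
move=> C0 D0; have [c cE] := iota_onto C0; have [d dE] := iota_onto D0.
have c0 : 0 <= c by rewrite -(iota_ge0 iota_mono) -cE.
have d0 : 0 <= d by rewrite -(iota_ge0 iota_mono) -dE.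
have [N N0 N_large] : exists2 N, (0 < N)%N & D *+ 2 <= N%:R.
  pose N := (Num.bound (2 * d)).+1; exists N; first by [].
  rewrite dE -(rmorph_nat iota N) -rmorphMn iota_mono -mulr_natl.
  apply/ltW/(lt_trans (archi_boundP _)); first by rewrite mulr_ge0.
  by rewrite ltr_nat.
exists (2 * c + 1), (ln 2 / N%:R); split; first by rewrite ltr_wpDl // mulr_ge0.
  by rewrite divr_gt0 ?ln_gt0 ?ltr1n ?ltr0n.
move=> T g g0 growth linear_decay j jT.
have halve i : (i + N <= T)%N -> g (i + N)%N <= 2^-1 * g i.
  move=> iT.
  have h : N%:R * g (i + N)%N <= D * g i.
    have := linear_decay i (i + N)%N; rewrite addKn; apply.
    by rewrite leq_addr.
  have N2 : 0 < N%:R * 2 :> K by rewrite mulr_gt0 ?ltr0n.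
  rewrite -(ler_pM2l N2) [leRHS]mulrA mulfK ?pnatr_eq0 // mulrAC mulr_natr.
  apply: (@le_trans _ _ (D * g i *+ 2)).
    by rewrite lerMn2r h.
  by rewrite -mulrnAl ler_wpM2r.
have halves q : (q * N <= T)%N -> g (q * N)%N <= 2^-1 ^+ q * g 0%N.
  elim: q => [|q IHq]; first by rewrite mul0n expr0 mul1r.
  rewrite mulSn addnC => qT; apply: (le_trans (halve _ qT)).
  rewrite exprS -mulrA ler_wpM2l ?invr_ge0 ?ler0n // IHq //.
  by apply: leq_trans qT; rewrite leq_addr.
have jN : (j %/ N * N <= j)%N by exact: leq_trunc_div.
apply: (le_trans (growth (j %/ N * N)%N j _)); first by rewrite jN.
apply: (@le_trans _ _ (C * (2^-1 ^+ (j %/ N) * g 0%N))).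
  by rewrite ler_wpM2l // halves // (leq_trans jN).
rewrite mulrA ler_wpM2r // cE.
have -> : 2^-1 = iota 2^-1 by rewrite fmorphV rmorph_nat.
rewrite -rmorphXn -rmorphM iota_mono.
have := @halving_le_expR N j N0.
set e := expR _; set h := _ ^+ _ => he.
have e0 : 0 <= e by exact: expR_ge0.
apply: (@le_trans _ _ (c * (2 * e))); first by rewrite ler_wpM2l.
by rewrite mulrA [c * 2]mulrC [leRHS]mulrDl [1 * e]mul1r lerDl.
Qed.

End ExponentialDecay.

(** * Products of the operators *)

Section Evolution.
Variables (K : numFieldType) (X : normedModType K) (A : nat -> {linear X -> X}).

Local Notation F := (forward_evolution A).

Lemma forward_evolution_le m n x : (m <= n)%N -> F m n x = x.
Proof. by rewrite /forward_evolution /index_iota -subn_eq0 => /eqP ->. Qed.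

Lemma forward_evolutionS m n x : (n <= m)%N -> F m.+1 n x = A m (F m n x).
Proof.
move=> nm; rewrite /forward_evolution /index_iota subSn // -addn1 iotaD.
by rewrite foldl_cat /= subnKC.
Qed.

Lemma forward_evolution_comp m k n x : (n <= k <= m)%N ->
  F m k (F k n x) = F m n x.
Proof.
move=> /andP[nk km]; rewrite -(subnK km); elim: (m - k)%N => [|i IHi].
  by rewrite add0n forward_evolution_le.
by rewrite addSn !forward_evolutionS ?IHi //; lia.
Qed.

Lemma forward_evolution_linear m n : linear (F m n).
Proof.
move=> a u v; have [mn|/ltnW nm] := leqP m n.
  by rewrite !forward_evolution_le.
rewrite -(subnK nm); elim: (m - n)%N => [|i IHi].
  by rewrite add0n !forward_evolution_le.
by rewrite addSn !forward_evolutionS ?IHi ?linearP ?leq_addl.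
Qed.

HB.instance Definition _ m n :=
  GRing.isLinear.Build K X X _ (forward_evolution A m n)
    (forward_evolution_linear m n).

Lemma trajectory_forward_evolution x m n : trajectory A x -> (n <= m)%N ->
  x m = F m n (x n).
Proof.
move=> xA nm; rewrite -(subnK nm); elim: (m - n)%N => [|i IHi].
  by rewrite add0n forward_evolution_le.
by rewrite addSn xA IHi forward_evolutionS ?leq_addl.
Qed.

(** Only the tail counts, so that moving the starting time of an orbit
    does not affect the property. *)
Definition eventually_bounded (u : nat -> X) : Prop :=
  exists m B, forall k, (m <= k)%N -> `|u k| <= B.

Lemma eventually_bounded_sup_norm_le u :
  eventually_bounded u -> exists2 B, 0 <= B & sup_norm_le u B.
Proof.
move=> [m [B uB]]; have B0 : 0 <= B by apply: le_trans (uB m (leqnn m)).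
exists (B + \sum_(i < m) `|u i|); first by rewrite addr_ge0 ?sumr_ge0.
move=> k; have [mk|km] := leqP m k.
  by apply: (le_trans (uB k mk)); rewrite lerDl sumr_ge0.
by rewrite (bigD1 (Ordinal km)) //= addrCA lerDl addr_ge0 ?sumr_ge0.
Qed.

End Evolution.

(** * Stable and unstable spaces of a system with shadowing *)

Section Shadowing.
Variables (K : numFieldType) (X : normedModType K) (A : nat -> {linear X -> X}).

Local Notation F := (forward_evolution A).

Definition stable n (x : X) : Prop := eventually_bounded (fun k => F k n x).

Definition unstable (Q : {linear X -> X}) n (x : X) : Prop :=
  exists2 w, Q w = 0 & x = F n 0%N w.

Lemma stable_subspace n : linear_subspace (stable n).
Proof.
split; first by exists 0%N, 0 => k _; rewrite linear0 normr0.
move=> a u v [m1 [B1 uB]] [m2 [B2 vB]]; exists (maxn m1 m2), (`|a| * B1 + B2) => k.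
rewrite geq_max => /andP[k1 k2]; rewrite linearP; apply: (le_trans (ler_normD _ _)).
by rewrite normrZ lerD ?vB // ler_wpM2l ?uB.
Qed.

Lemma unstable_subspace Q n : linear_subspace (unstable Q n).
Proof.
split; first by exists 0; rewrite linear0.
move=> a _ _ [u Qu ->] [v Qv ->]; exists (a *: u + v); last by rewrite linearP.
by rewrite linearP Qu Qv scaler0 addr0.
Qed.

Lemma stable_forward_evolution m n x : (n <= m)%N ->
  stable m (F m n x) <-> stable n x.
Proof.
move=> nm; split=> -[k0 [B xB]]; exists (maxn k0 m), B => k;
  rewrite geq_max => /andP[k0k mk].
  by rewrite -(@forward_evolution_comp _ _ A k m n) ?nm // xB.
by rewrite forward_evolution_comp ?nm // xB.
Qed.

Lemma stable_step n x : stable n x -> stable n.+1 (A n x).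
Proof.
move/(stable_forward_evolution x (leqnSn n)).
by rewrite forward_evolutionS // forward_evolution_le.
Qed.

Lemma unstable_step Q n x : unstable Q n x -> unstable Q n.+1 (A n x).
Proof. by move=> [w Qw ->]; exists w; rewrite // forward_evolutionS. Qed.

(** [Q] is a projection onto the stable space at time [0], and its kernel is the
    chosen unstable space at that time; [M] bounds the stable orbits from time [0],
    which no forcing can reach. *)
Variables (Q : {linear X -> X}) (L M : K).
Hypothesis L_gt0 : 0 < L.
Hypothesis shadowing : forall eps : K, 0 < eps -> forall y : nat -> X,
  pseudotrajectory A (L * eps) y ->
  exists2 x : nat -> X, trajectory A x & sup_norm_le (fun n => x n - y n) eps.
Hypothesis M_ge0 : 0 <= M.
Hypothesis Q_stable : forall x, stable 0 (Q x).
Hypothesis Q_id : forall x, stable 0 x -> Q x = x.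
Hypothesis Q_bound : forall m x, `|F m 0%N (Q x)| <= M * `|x|.

(** The shadowing orbit [x] of [z] contributes [M / L], and the distance from [x] to
    [z] contributes [1 / L]. *)
Definition perron_const : K := (M + 1) / L.
(** One constant for all bounds: [perron_const] at positive times, [M] at time [0],
    and [1] for the identity. *)
Definition growth_const : K := perron_const + M + 1.

Lemma perron_const_ge0 : 0 <= perron_const.
Proof. by rewrite divr_ge0 ?(ltW L_gt0) ?addr_ge0. Qed.

Lemma growth_const_ge0 : 0 <= growth_const.
Proof. by rewrite !addr_ge0 ?perron_const_ge0. Qed.

(** A bounded [z] is itself a pseudotrajectory; its shadow [x] is then bounded as
    well, so it is the orbit of [x 0 = Q (x 0)].  As [Q (z 0) = 0], this vector is
    also [Q (x 0 - z 0)], which is small, and so is the whole orbit [x]. *)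
Lemma perron_estimate (z : nat -> X) (c : K) :
  eventually_bounded z -> Q (z 0%N) = 0 -> 0 <= c ->
  (forall k, `|z k.+1 - A k (z k)| <= c) -> forall n, `|z n| <= perron_const * c.
Proof.
move=> [m [B zB]] Qz0; rewrite le0r => /predU1P[->|c_gt0] zc n.
  (* Without forcing, [z 0] lies both in the range and in the kernel of [Q]. *)
  have z_traj : trajectory A z.
    by move=> k; apply/eqP; rewrite -subr_eq0 -normr_le0.
  have z0 : z 0%N = 0.
    rewrite -Qz0 Q_id //; exists m, B => k mk.
    by rewrite -(trajectory_forward_evolution z_traj) // zB.
  by rewrite (trajectory_forward_evolution z_traj (leq0n n)) z0 linear0 normr0 mulr0.
have [|x x_traj x_near] := shadowing (divr_gt0 c_gt0 L_gt0) (y := z).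
  by move=> k /=; rewrite mulrCA mulfV ?mulr1 ?gt_eqF.
have x0 : Q (x 0%N) = x 0%N.
  apply: Q_id; exists m, (c / L + B) => k mk.
  rewrite -(trajectory_forward_evolution x_traj) // -[x k](subrK (z k)).
  by apply: (le_trans (ler_normD _ _)); rewrite lerD ?zB //; exact: x_near.
have xn : `|x n| <= M * (c / L).
  rewrite (trajectory_forward_evolution x_traj (leq0n n)) -x0.
  have -> : Q (x 0%N) = Q (x 0%N - z 0%N) by rewrite linearB Qz0 subr0.
  by apply: (le_trans (Q_bound _ _)); rewrite ler_wpM2l //; exact: x_near.
have -> : z n = x n - (x n - z n) by rewrite opprB addrC subrK.
apply: (le_trans (ler_normB _ _)).
rewrite /perron_const -mulrA [L^-1 * c]mulrC mulrDl mul1r lerD //; exact: x_near.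
Qed.

Lemma stable_unstable0 n x : stable n x -> unstable Q n x -> x = 0.
Proof.
move=> Sx [w Qw xE]; have : w = 0; last by rewrite xE => ->; rewrite linear0.
by rewrite -Qw Q_id //; apply/(stable_forward_evolution w (leq0n n)); rewrite -xE.
Qed.

(** Start the orbit of [x] at time [n], preceded by zeros.  If [t] shadows this
    pseudotrajectory, then [x - t n] is stable, while [t n] comes from time [0],
    where [Q] splits the space. *)
Lemma stable_unstable_split n x : exists s, stable n s /\ unstable Q n (x - s).
Proof.
pose y k := if (k < n)%N then 0 else F k n x.
have y_step k : `|y k.+1 - A k (y k)| <= `|x|.
  rewrite /y; case: ltngtP => kn; [| |].
  - by rewrite linear0 subr0 normr0.
  - by rewrite forward_evolutionS // subrr normr0.
  - by rewrite -kn linear0 subr0 forward_evolution_le.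
have [eps eps_gt0 x_eps] : exists2 eps : K, 0 < eps & `|x| <= L * eps.
  exists ((`|x| + 1) / L); first by rewrite divr_gt0 // ltr_wpDl.
  by rewrite mulrCA mulfV ?gt_eqF // mulr1 lerDl.
have [|t t_traj t_near] := shadowing eps_gt0 (y := y).
  by move=> k; apply: le_trans x_eps.
have tE k : (n <= k)%N -> F k n (t n) = t k.
  by move=> nk; rewrite -trajectory_forward_evolution.
exists (x - t n + F n 0%N (Q (t 0%N))); split.
  apply: linear_subspaceD; first exact: stable_subspace.
    exists n, eps => k nk; rewrite linearB /= tE //.
    by have := t_near k; rewrite /y ltnNge nk /= distrC.
  exact/stable_forward_evolution.
exists (t 0%N - Q (t 0%N)); first by rewrite linearB /= (Q_id (Q_stable _)) subrr.
by rewrite linearB /= -trajectory_forward_evolution // opprD addrA subKr.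
Qed.

(** The bounded solution whose only forcing is the vector [s + F n 0 w] at time
    [n - 1] has its stable part after that time and its unstable part, with the
    opposite sign, before. *)
Lemma green_estimate n s w : (0 < n)%N -> stable n s -> Q w = 0 ->
  (forall k, (n <= k)%N -> `|F k n s| <= perron_const * `|s + F n 0%N w|) /\
  (forall k, (k < n)%N -> `|F k 0%N w| <= perron_const * `|s + F n 0%N w|).
Proof.
move=> n_gt0 [m [B sB]] Qw.
pose z k := if (k < n)%N then - F k 0%N w else F k n s.
have z_le k : `|z k| <= perron_const * `|s + F n 0%N w|.
  apply: perron_estimate => //.
  - exists (maxn m n), B => i; rewrite geq_max => /andP[mi ni].
    by rewrite /z ltnNge ni /= sB.
  - by rewrite /z n_gt0 forward_evolution_le // linearN Qw oppr0.
  - move=> i; rewrite /z; case: ltngtP => i_n.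
    + by rewrite forward_evolutionS // linearN subrr normr0.
    + by rewrite forward_evolutionS // subrr normr0.
    + rewrite -i_n linearN opprK forward_evolution_le //.
      by rewrite -[A i _]forward_evolutionS.
split=> k kn; have := z_le k; rewrite /z.
  by rewrite ltnNge kn.
by rewrite kn normrN.
Qed.

Lemma stable_growth n m x : stable n x -> (n <= m)%N ->
  `|F m n x| <= growth_const * `|x|.
Proof.
move=> Sx nm; have [n0|n_gt0] := posnP n.
  rewrite n0 in Sx *; rewrite -{1}(Q_id Sx); apply: (le_trans (Q_bound _ _)).
  by rewrite ler_wpM2r // /growth_const -addrA addrCA lerDl addr_ge0 ?perron_const_ge0.
have [h _] := green_estimate n_gt0 Sx (linear0 Q).
move: (h m nm); rewrite linear0 addr0 => /le_trans; apply.
by rewrite ler_wpM2r // /growth_const -addrA lerDl addr_ge0.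
Qed.

Lemma unstable_growth n m w : Q w = 0 -> (m <= n)%N ->
  `|F m 0%N w| <= growth_const * `|F n 0%N w|.
Proof.
move=> Qw; rewrite leq_eqVlt => /predU1P[->|mn].
  by rewrite ler_peMl // /growth_const lerDr addr_ge0 ?perron_const_ge0.
have n_gt0 : (0 < n)%N by apply: leq_ltn_trans mn.
have [_ h] := green_estimate n_gt0 (proj1 (stable_subspace n)) Qw.
move: (h m mn); rewrite add0r => /le_trans; apply.
by rewrite ler_wpM2r // /growth_const -addrA lerDl addr_ge0.
Qed.

Lemma stable_component_le n s x : stable n s -> unstable Q n (x - s) ->
  `|s| <= growth_const * `|x|.
Proof.
move=> Ss [w Qw xE].
have {xE} -> : x = s + F n 0%N w by rewrite -xE addrC subrK.
have [n0|n_gt0] := posnP n.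
  rewrite n0 in Ss *; rewrite [F _ _ w]forward_evolution_le //.
  have -> : s = F 0%N 0%N (Q (s + w)).
    by rewrite forward_evolution_le // linearD Qw addr0 Q_id.
  rewrite {2}forward_evolution_le // [Q (s + w) in leRHS]linearD Qw addr0 (Q_id Ss).
  apply: (le_trans (Q_bound _ _)).
  by rewrite ler_wpM2r // /growth_const -addrA addrCA lerDl addr_ge0 ?perron_const_ge0.
have [h _] := green_estimate n_gt0 Ss Qw.
move: (h n (leqnn n)); rewrite forward_evolution_le // => /le_trans; apply.
by rewrite ler_wpM2r // /growth_const -addrA lerDl addr_ge0.
Qed.

(** Summing an orbit along itself: the solution forced by the orbit grows linearly
    compared with the orbit, yet it must remain bounded. *)
Lemma stable_linear_decay n m x : stable n x -> (n <= m)%N ->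
  (m - n)%:R * `|F m n x| <= perron_const * growth_const * `|x|.
Proof.
move=> Sx nm.
(* The truncated subtraction makes this sequence vanish for [k <= n]; the weight
   increases by one at each step from [n] to [m], which produces the forcing
   [F k.+1 n x], and is constant afterwards. *)
pose z k := (minn k m - n)%:R *: F k n x.
have zm : `|z m| = (m - n)%:R * `|F m n x|.
  by rewrite /z minnn normrZ normr_nat.
rewrite -zm -mulrA; apply: perron_estimate.
- have [k0 [B xB]] := Sx; exists k0, (m%:R * B) => k k0k.
  by rewrite normrZ normr_nat ler_pM ?xB // ler_nat; lia.
- by rewrite /z min0n sub0n scale0r linear0.
- by rewrite mulr_ge0 ?growth_const_ge0.
move=> k; have [kn|nk] := ltnP k n.
  have -> : z k = 0 by rewrite /z (_ : _ - _ = 0)%N ?scale0r //; lia.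
  have -> : z k.+1 = 0 by rewrite /z (_ : _ - _ = 0)%N ?scale0r //; lia.
  by rewrite linear0 subr0 normr0 mulr_ge0 ?growth_const_ge0.
rewrite /z linearZ /= -forward_evolutionS // -scalerBl normrZ.
apply: (@le_trans _ _ (1 * `|F k.+1 n x|)).
  rewrite ler_wpM2r // -natrB; last by lia.
  by rewrite normr_nat (ler_nat _ _ 1%N); lia.
by rewrite mul1r stable_growth // ltnW.
Qed.

(** The mirror image of [stable_linear_decay]: the weights now vanish at the end of
    the time interval, and [Q w = 0] makes the solution admissible at time [0]. *)
Lemma unstable_linear_decay n m w : Q w = 0 -> (m <= n)%N ->
  (n - m)%:R * `|F m 0%N w| <= perron_const * growth_const * `|F n 0%N w|.
Proof.
move=> Qw mn.
(* The weight is constant up to time [m], then decreases by one at each step,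
   which produces the forcing [- F k.+1 0 w], and is [0] from time [n] on. *)
pose z k := (n - maxn k m)%:R *: F k 0%N w.
have zm : `|z m| = (n - m)%:R * `|F m 0%N w|.
  by rewrite /z maxnn normrZ normr_nat.
rewrite -zm -mulrA; apply: perron_estimate.
- exists n, 0 => k nk; rewrite /z (_ : _ - _ = 0)%N ?scale0r ?normr0 //; lia.
- by rewrite /z forward_evolution_le // linearZ /= Qw scaler0.
- by rewrite mulr_ge0 ?growth_const_ge0.
move=> k; rewrite /z linearZ /= -forward_evolutionS // -scalerBl normrZ.
have [nk|kn] := leqP n k.
  have -> : (n - maxn k.+1 m = 0)%N by lia.
  have -> : (n - maxn k m = 0)%N by lia.
  by rewrite subrr normr0 mul0r mulr_ge0 ?growth_const_ge0.
apply: (@le_trans _ _ (1 * `|F k.+1 0%N w|)).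
  rewrite ler_wpM2r // distrC -natrB; last by lia.
  by rewrite normr_nat (ler_nat _ _ 1%N); lia.
by rewrite mul1r unstable_growth.
Qed.

Section Dichotomy.
Variable P : nat -> {linear X -> X}.
Hypothesis P_split : forall n x, stable n (P n x) /\ unstable Q n (x - P n x).

Lemma splitting_unique n x s : stable n s -> unstable Q n (x - s) -> P n x = s.
Proof.
move=> Ss Us; have [SP UP] := P_split n x.
apply/eqP; rewrite -subr_eq0; apply/eqP/(@stable_unstable0 n).
  exact: linear_subspaceB (stable_subspace n) SP Ss.
have -> : P n x - s = (x - s) - (x - P n x) by rewrite opprB [RHS]addrC addrA subrK.
exact: linear_subspaceB (unstable_subspace Q n) Us UP.
Qed.

Lemma projection_stable n s : stable n s -> P n s = s.
Proof.
move=> Ss; apply: splitting_unique => //; rewrite subrr.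
by case: (unstable_subspace Q n).
Qed.

Lemma ker_projection n x : ker (P n) x <-> unstable Q n x.
Proof.
split=> [Px|Ux]; first by have [_] := P_split n x; rewrite Px subr0.
by apply: splitting_unique; rewrite ?subr0 //; case: (stable_subspace n).
Qed.

Lemma forward_evolution_unstable_inj n w1 w2 : Q w1 = 0 -> Q w2 = 0 ->
  F n 0%N w1 = F n 0%N w2 -> w1 = w2.
Proof.
move=> Q1 Q2 /eqP; rewrite -subr_eq0 -linearB => /eqP F0.
have Sw : stable 0 (w1 - w2).
  apply/(stable_forward_evolution (w1 - w2) (leq0n n)).
  by rewrite F0; case: (stable_subspace n).
by apply/eqP; rewrite -subr_eq0 -(Q_id Sw) linearB Q1 Q2 subr0.
Qed.

Lemma evolution_unstable m n w : Q w = 0 -> (m <= n)%N ->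
  evolution A P m n (F n 0%N w) = F m 0%N w.
Proof.
move=> Qw; rewrite /evolution leq_eqVlt => /predU1P[->|mn].
  by rewrite leqnn forward_evolution_le.
rewrite leqNgt mn /= -(@forward_evolution_comp _ _ A n m 0) ?(ltnW mn) //.
apply: pinvKV; last by rewrite inE; apply/ker_projection; exists w.
move=> _ _ /set_mem/ker_projection[w1 Q1 ->] /set_mem/ker_projection[w2 Q2 ->].
rewrite !forward_evolution_comp ?(ltnW mn) // => w12.
by rewrite (forward_evolution_unstable_inj Q1 Q2 w12).
Qed.

End Dichotomy.

(** The linear decay holds between any two times of an orbit, so [exp_decay] applies
    with constants that are the same for all orbits and all starting times. *)
Lemma dichotomy_of_splitting (R : realType) (iota : {rmorphism R -> K}) :
  {mono iota : r s / r <= s} -> (forall k : K, 0 <= k -> exists r, k = iota r) ->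
  exponential_dichotomy iota A.
Proof.
move=> iota_mono iota_onto.
have /boolp.choice[P P_split] : forall n, exists P : {linear X -> X},
    forall x, stable n (P x) /\ unstable Q n (x - P x).
  move=> n; apply: direct_sum_projection.
  - exact: stable_subspace.
  - exact: unstable_subspace.
  - exact: stable_unstable0.
  - exact: stable_unstable_split.
have [C [lambda [C_gt0 lambda_gt0 decay]]] :=
  exp_decay iota_mono iota_onto growth_const_ge0 (mulr_ge0 perron_const_ge0 growth_const_ge0).
(* [c] bounds the norms of [P n] and of the complementary projection. *)
have [c cE] := iota_onto _ (addr_ge0 growth_const_ge0 ler01).
have c_gt0 : 0 < c.
  rewrite lt_neqAle -(iota_ge0 iota_mono) -cE addr_ge0 ?growth_const_ge0 // andbT.
  rewrite -(inj_eq (fmorph_inj iota)) rmorph0 -cE eq_sym gt_eqF //.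
  by rewrite ltr_wpDl // growth_const_ge0.
have finish (t : R) (x y v : X) : `|v| <= iota (C * t) * `|y| ->
    0 <= t -> `|y| <= (growth_const + 1) * `|x| -> `|v| <= iota (C * c * t) * `|x|.
  move=> vy t_ge0 yx; apply: (le_trans vy).
  rewrite [C * c * t]mulrAC [iota (C * t * c)]rmorphM -mulrA -cE ler_wpM2l // iota_ge0 // mulr_ge0 //.
  exact: ltW.
have P_le n x : `|P n x| <= growth_const * `|x|.
  by have [SP UP] := P_split n x; exact: stable_component_le SP UP.
exists P; split.
- by move=> m x; apply: projection_stable => //; case: (P_split m x).
- move=> m x; have [SP UP] := P_split m x; apply: splitting_unique => //.
    exact: stable_step.
  by rewrite -linearB; exact: unstable_step.
- move=> m; split.
  + by move=> x /(ker_projection P_split)/unstable_step/(ker_projection P_split).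
  + move=> _ _ /set_mem/(ker_projection P_split)[w1 Q1 ->]
      /set_mem/(ker_projection P_split)[w2 Q2 ->].
    rewrite -!forward_evolutionS // => /(forward_evolution_unstable_inj Q1 Q2) ->.
    by [].
  + move=> y /(ker_projection P_split)[w Qw ->]; exists (F m 0%N w).
      by apply/(ker_projection P_split); exists w.
    by rewrite forward_evolutionS.
exists (C * c), lambda; split => //; first by rewrite mulr_gt0.
- move=> m n nm x; rewrite /evolution nm -natrB //.
  apply: (@finish _ x (P n x)); last 2 first.
  + exact: expR_ge0.
  + by apply: (le_trans (P_le n x)); rewrite ler_wpM2r // lerDl.
  have [SP _] := P_split n x.
  have S j : stable (n + j) (F (n + j) n (P n x)).
    by apply/stable_forward_evolution => //; rewrite leq_addr.
  pose g j := `|F (n + j) n (P n x)|.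
  suff : g (m - n)%N <= iota (C * expR (- lambda * (m - n)%:R)) * g 0%N.
    by rewrite /g addn0 subnKC // [F n n _]forward_evolution_le.
  apply: (decay (m - n)%N); rewrite /g //.
  + move=> i j /andP[ij _].
    rewrite -(@forward_evolution_comp _ _ A (n + j) (n + i) n); last by lia.
    by apply: stable_growth; rewrite ?S // leq_add2l.
  + move=> i j /andP[ij _].
    rewrite -(@forward_evolution_comp _ _ A (n + j) (n + i) n); last by lia.
    rewrite -(subnDl n j i).
    by apply: stable_linear_decay; rewrite ?S // leq_add2l.
- move=> m n mn x; rewrite -natrB //.
  apply: (@finish _ x (x - P n x)); last 2 first.
  + exact: expR_ge0.
  + by rewrite mulrDl mul1r [leRHS]addrC; apply: (le_trans (ler_normB _ _)); rewrite lerD.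
  have [_ [w Qw ->]] := P_split n x; rewrite evolution_unstable //.
  pose g j := `|F (n - j) 0%N w|.
  suff : g (n - m)%N <= iota (C * expR (- lambda * (n - m)%:R)) * g 0%N.
    by rewrite /g subn0 subKn.
  apply: (decay (n - m)%N); rewrite /g //.
  + by move=> i j ij; apply: unstable_growth => //; lia.
  + move=> i j ij; have -> : (j - i = (n - i) - (n - j))%N by lia.
    by apply: unstable_linear_decay => //; lia.
Qed.

End Shadowing.

(** * The finite-dimensional case *)

Section FiniteDimensionalShadowing.
Variables (R : realType) (K : numFieldType) (iota : {rmorphism R -> K}).
Hypothesis iota_mono : {mono iota : r s / r <= s}.
Hypothesis iota_onto : forall k : K, 0 <= k -> exists r, k = iota r.
(** [omega] is [0] for the real scalars and the imaginary unit for the complex ones. *)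
Variable omega : K.
Hypothesis K_real_span : forall k : K, exists a b, k = iota a + iota b * omega.
Variables (X : normedModType K) (A : nat -> {linear X -> X}).

Lemma finite_dimensional_bounded_coordinates : finite_dimensional X ->
  exists d (g : 'I_d -> X) (M : K), 0 <= M /\ forall x, exists2 a : 'I_d -> K,
    x = \sum_i a i *: g i & forall i, `|a i| <= M * `|x|.
Proof.
move=> [d [e e_span]].
pose f (i : 'I_(d + d)) := match fintype.split i with inl j => e j | inr j => omega *: e j end.
apply: (bounded_real_coordinates iota_mono iota_onto (f := f)) => x.
have [k ->] := e_span x.
have /boolp.choice[a /boolp.choice[b kE]] : forall i, exists a, exists b,
  k i = iota a + iota b * omega by move=> i; exact: K_real_span.
exists (fun i => match fintype.split i with inl j => a j | inr j => b j end).
rewrite big_split_ord /= -big_split /f /=; apply: eq_bigr => i _.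
have -> : fintype.split (lshift d i) = inl i by exact: (unsplitK (inl i)).
have -> : fintype.split (rshift d i) = inr i by exact: (unsplitK (inr i)).
by rewrite kE scalerDl scalerA.
Qed.

Lemma shadowing_dichotomy : finite_dimensional X ->
  lipschitz_shadowing A -> exponential_dichotomy iota A.
Proof.
move=> fdX [L L_gt0 shadowing].
have [Q Q_onto] := projection_onto fdX (stable_subspace A 0).
have Q_stable x : stable A 0 (Q x) by case: (Q_onto x).
have Q_id x : stable A 0 x -> Q x = x by case: (Q_onto x).
have [d [g [M [M_ge0 g_coord]]]] := finite_dimensional_bounded_coordinates fdX.
have /boolp.choice[B B_orbit] : forall i, exists B : K,
    0 <= B /\ forall m, `|forward_evolution A m 0 (Q (g i))| <= B.
  move=> i; have [B B0 hB] := eventually_bounded_sup_norm_le (Q_stable (g i)).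
  by exists B.
have B_ge0 i : 0 <= B i by case: (B_orbit i).
(* It suffices to bound the orbits of the finitely many vectors [Q (g i)]. *)
have Q_bound m x :
    `|forward_evolution A m 0 (Q x)| <= M * (\sum_i B i) * `|x|.
  have [a xE a_le] := g_coord x; rewrite [in leLHS]xE !linear_sum /=.
  apply: (le_trans (ler_norm_sum _ _ _)).
  rewrite mulrAC mulr_sumr; apply: ler_sum => i _.
  by rewrite !linearZ /= normrZ ler_pM //; case: (B_orbit i).
apply: (dichotomy_of_splitting L_gt0 shadowing _ Q_stable Q_id Q_bound) => //.
by rewrite mulr_ge0 ?sumr_ge0.
Qed.

End FiniteDimensionalShadowing.

Theorem proposition4 (R : realType) :
  (forall (X : completeNormedModType R) (A : nat -> {linear X -> X}),
     finite_dimensional X -> (forall m : nat, continuous (A m)) ->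
     lipschitz_shadowing A -> exponential_dichotomy (fun r : R => r) A)
  /\
  (forall (X : completeNormedModType R[i]) (A : nat -> {linear X -> X}),
     finite_dimensional X -> (forall m : nat, continuous (A m)) ->
     lipschitz_shadowing A -> exponential_dichotomy (fun r : R => r%:C) A).
Proof.
split=> X A fdX _ shadowing.
  apply: (@shadowing_dichotomy R R idfun _ _ 0 _ X A fdX shadowing) => //.
    by move=> k _; exists k.
  by move=> k; exists k, 0; rewrite mul0r addr0.
apply: (@shadowing_dichotomy R R[i] (real_complex R) _ _ 'i _ X A fdX shadowing).
- by move=> r s; rewrite lecR.
- by move=> k k_ge0; apply/complex_realP/ger0_real.
- move=> k; exists (complex.Re k), (complex.Im k); rewrite {1}[k]complexE.
  by rewrite mulrC.
Qed.
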